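(* Let $d$ be a degree sequence, let $R$ be a labeled realization of $d$, and let $n\ge 4$. Then $R$ belongs to a clique of size $n$ in the realization graph $\mathcal{G}(d)$ if and only if $R$ contains the configuration $\mathcal{D}_n$. Furthermore, in this case, for such a clique, moving in $\mathcal{G}(d)$ from $R$ to another vertex of the clique corresponds precisely to performing a 2-switch on an alternating 4-cycle all of whose edges and non-edges belong to (the image of) the configuration $\mathcal{D}_n$ in $R$.
   Context: All graphs are finite and simple. A labeled realization of a degree sequence $d=(d_1,\dots,d_n)$ is a graph on the fixed vertex set $\{v_1,\dots,v_n\}$ in which $v_i$ has degree $d_i$. An alternating 4-cycle $[u,v:w,x]$ in a graph $H$ consists of four distinct vertices $u,v,w,x$ with $uv,wx\in E(H)$ and $ux,vw\notin E(H)$ (nothing is required of the pairs $\{u,w\},\{v,x\}$). A 2-switch on it deletes $uv,wx$ and adds $ux,vw$. The realization graph $\mathcal{G}(d)$ has the labeled realizations of $d$ as vertices, two being adjacent when one is obtained from the other by a single 2-switch. A configuration is a triple $(W,F,F')$ where $W$ is a set and $F,F'$ are disjoint sets of 2-element subsets of $W$; a graph $H$ contains it if there is an injective map $f:W\to V(H)$ sending each pair of $F$ to an edge of $H$ and each pair of $F'$ to a non-edge of $H$ (no condition on other pairs). $\mathcal{D}_n$ is the configuration with $n+2$ vertices $u,v,w_1,\dots,w_n$, edges $F=\{uw_1\}\cup\{vw_i: 2\le i\le n\}$ and non-edges $F'=\{vw_1\}\cup\{uw_i:2\le i\le n\}$. *)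

(* Defs.v *)
From HB Require Import structures.
From mathcomp Require Import all_boot.

Set Implicit Arguments.
Unset Strict Implicit.
Unset Printing Implicit Defensive.

Record sgraph (V : finType) := SGraph {
  edges : {set {set V}};
  _ : [forall e in edges, #|e| == 2] }.

HB.instance Definition _ (V : finType) := [isSub for @edges V].
HB.instance Definition _ (V : finType) := [Finite of sgraph V by <:].

Definition degree (V : finType) (G : sgraph V) (v : V) : nat :=
  #|[set e in edges G | v \in e]|.

Definition clique (V : finType) (G : sgraph V) (K : {set V}) : bool :=
  [forall x in K, forall y in K, (x != y) ==> ([set x; y] \in edges G)].

(* The alternating 4-cycle [u, v : w, x]. *)
Definition alt4 (V : finType) (H : sgraph V) (u v w x : V) : bool :=
  [&& uniq [:: u; v; w; x],
      [set u; v] \in edges H, [set w; x] \in edges H,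
      [set u; x] \notin edges H & [set v; w] \notin edges H].

Definition switched (V : finType) (H : sgraph V) (u v w x : V) :
    {set {set V}} :=
  (edges H :\: [set [set u; v]; [set w; x]]) :|: [set [set u; x]; [set v; w]].

Definition two_switch (V : finType) (H H' : sgraph V) : bool :=
  [exists u, exists v, exists w, exists x,
    alt4 H u v w x && (edges H' == switched H u v w x)].

Record realization (m : nat) (d : m.-tuple nat) := Realization {
  rgraph_of :> sgraph 'I_m;
  _ : [forall i, degree rgraph_of i == tnth d i] }.

HB.instance Definition _ (m : nat) (d : m.-tuple nat) :=
  [isSub for @rgraph_of m d].
HB.instance Definition _ (m : nat) (d : m.-tuple nat) :=
  [Finite of realization d by <:].

Definition realization_edges (m : nat) (d : m.-tuple nat) :
    {set {set realization d}} :=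
  [set e | [exists A : realization d, exists B : realization d,
              (e == [set A; B]) && two_switch A B]].

Lemma two_switch_irrefl (V : finType) (H : sgraph V) : ~~ two_switch H H.
Proof.
apply/negP => /existsP[u /existsP[v /existsP[w /existsP[x]]]].
case/andP => /and5P[_ _ _ Hux _] /eqP E.
by move: Hux; rewrite E !inE eqxx !orbT.
Qed.

Lemma realization_edges_subproof (m : nat) (d : m.-tuple nat) :
  [forall e in realization_edges d, #|e| == 2].
Proof.
apply/forall_inP => e; rewrite inE => /existsP[A /existsP[B /andP[/eqP-> sAB]]].
rewrite cards2; case: (eqVneq A B) sAB => // ->.
by rewrite (negbTE (two_switch_irrefl _)).
Qed.

Definition realization_graph (m : nat) (d : m.-tuple nat) :
    sgraph (realization d) :=
  SGraph (realization_edges_subproof d).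

Record config := Config {
  cvert : finType;
  cedges : {set {set cvert}};
  cnonedges : {set {set cvert}};
  _ : [forall e in cedges, #|e| == 2];
  _ : [forall e in cnonedges, #|e| == 2];
  _ : [disjoint cedges & cnonedges] }.

Definition config_copy (C : config) (V : finType) (H : sgraph V)
    (f : cvert C -> V) : Prop :=
  [/\ injective f,
      forall e, e \in cedges C -> f @: e \in edges H
    & forall e, e \in cnonedges C -> f @: e \notin edges H].

Definition contains (V : finType) (H : sgraph V) (C : config) : Prop :=
  exists f : cvert C -> V, config_copy H f.

(* u and v are the two booleans and w_k is the index k - 1, so that w_1 is
   selected by [val i == 0] and w_2, ..., w_n by [val i != 0]. *)
Definition Dvert (n : nat) : finType := (bool + 'I_n)%type.
Definition Du (n : nat) : Dvert n := inl true.
Definition Dv (n : nat) : Dvert n := inl false.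
Definition Dw (n : nat) (i : 'I_n) : Dvert n := inr i.

Definition Dedges (n : nat) : {set {set Dvert n}} :=
  [set [set Du n; Dw i] | i : 'I_n & val i == 0] :|:
  [set [set Dv n; Dw i] | i : 'I_n & val i != 0].

Definition Dnonedges (n : nat) : {set {set Dvert n}} :=
  [set [set Dv n; Dw i] | i : 'I_n & val i == 0] :|:
  [set [set Du n; Dw i] | i : 'I_n & val i != 0].

Lemma Dedges_card (n : nat) : [forall e in Dedges n, #|e| == 2].
Proof.
by apply/forall_inP => e /setUP[] /imsetP[i _ ->]; rewrite cards2.
Qed.

Lemma Dnonedges_card (n : nat) : [forall e in Dnonedges n, #|e| == 2].
Proof.
by apply/forall_inP => e /setUP[] /imsetP[i _ ->]; rewrite cards2.
Qed.

Lemma Dedges_disjoint (n : nat) : [disjoint Dedges n & Dnonedges n].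
Proof.
apply/pred0P => e /=; apply/negP => /andP[].
have Dw_inj (x : Dvert n) (i j : 'I_n) :
    [set x; Dw i] = [set x; Dw j] -> x \in [set Du n; Dv n] -> i = j.
  move=> /setP/(_ (Dw i)); rewrite !inE eqxx orbT.
  by move=> /esym/orP[/eqP<- //|/eqP[]].
have DuDv (i j : 'I_n) : [set Du n; Dw i] <> [set Dv n; Dw j].
  by move=> /setP/(_ (Du n)); rewrite !inE eqxx.
case/setUP => /imsetP[i]; rewrite inE => i0 ->;
  case/setUP => /imsetP[j]; rewrite inE => j0 E.
- exact: DuDv E.
- by move: j0; rewrite -(Dw_inj _ _ _ E) ?i0 // !inE eqxx.
- by move: i0; rewrite (Dw_inj _ _ _ E) ?j0 // !inE eqxx.
- exact: DuDv (esym E).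
Qed.

Definition Dconf (n : nat) : config :=
  Config (Dedges_card n) (Dnonedges_card n) (Dedges_disjoint n).

Definition alt4_in_copy (C : config) (V : finType) (f : cvert C -> V)
    (u v w x : V) : Prop :=
  let F := [set f @: (e : {set cvert C}) | e in cedges C] in
  let F' := [set f @: (e : {set cvert C}) | e in cnonedges C] in
  [/\ [set u; v] \in F, [set w; x] \in F, [set u; x] \in F'
    & [set v; w] \in F'].

(* Main.v *)
(* The set of pairs in which two adjacent realizations differ is an alternating
   4-cycle, so the vertices H of a clique through R give alternating 4-cycles
   S_H of R whose pairwise symmetric differences also have four elements, i.e.
   which pairwise share exactly two sides.  Three or more such cycles must all
   contain the same path a-b-c (ab an edge, bc a non-edge): otherwise two sides
   of one of them would violate the alternation.  Writing S_H = a b c x_H, the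
   pairs in the cycles S_H form D_n with u = a, v = c, w_1 = b and the x_H as
   the other w_i.  Conversely the switches along the cycles a b c w_i of a copy
   of D_n are pairwise related by the 2-switch along a w_i c w_j. *)
Require Import Defs.
From mathcomp Require Import all_boot.

Set Implicit Arguments.
Unset Strict Implicit.
Unset Printing Implicit Defensive.

(** * Alternating 4-cycles for a two-colouring of the pairs of vertices *)

Section AlternatingCycles.

Variable V : finType.
Implicit Types (E : pred {set V}) (S A B : {set {set V}}) (p q : {set V}).
Implicit Types (a b c e x y : V).

Lemma eq_set2 a b c e :
  [set a; b] = [set c; e] -> (a = c /\ b = e) \/ (a = e /\ b = c).
Proof.
move=> /setP eq_ab.
have := eq_ab a; have := eq_ab b; have := eq_ab c; have := eq_ab e.
rewrite !inE !eqxx !orbT.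
by do 4![case/esym/orP=> /eqP ? | case/orP=> /eqP ?]; subst; auto.
Qed.

Lemma set2_inj a b c : [set a; b] = [set a; c] -> b = c.
Proof. by case/eq_set2=> [[_]|[-> ->]]. Qed.

(** The sides are listed as two pairs of opposite sides: in an alternating cycle the first two are
    the edges and the last two the non-edges. *)
Definition cyc4 a b c e : {set {set V}} :=
  [set [set a; b]; [set c; e]; [set a; e]; [set b; c]].

(** The edges are an arbitrary predicate [E] on pairs, so that passing to [predC E] exchanges edges
    and non-edges and halves many arguments. *)
Definition alternating E a b c e : bool :=
  [&& uniq [:: a; b; c; e], E [set a; b], E [set c; e],
      ~~ E [set a; e] & ~~ E [set b; c]].

Definition alt_cycle E S : Prop :=
  exists a b c e, alternating E a b c e /\ S = cyc4 a b c e.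

Lemma alternatingC E a b c e :
  alternating E a b c e -> alternating (predC E) b c e a.
Proof.
case/and5P=> U ab ce ae bc; apply/and5P; split=> //=.
- by rewrite -(rot_uniq 1) in U.
- by rewrite setUC.
- by rewrite setUC negbK.
- by rewrite negbK.
Qed.

Lemma alternating_rot2 E a b c e :
  alternating E a b c e -> alternating E c e a b.
Proof.
case/and5P=> U ab ce ae bc; apply/and5P; split=> //.
- by rewrite -(rot_uniq 2) in U.
- by rewrite setUC.
- by rewrite setUC.
Qed.

Lemma alternating_flip E a b c e :
  alternating E a b c e -> alternating E b a e c.
Proof.
case/and5P=> U ab ce ae bc; apply/and5P; split; rewrite // 1?setUC //.
by rewrite -rev_uniq -(rot_uniq 2) in U.
Qed.

Lemma cyc4_rot a b c e : cyc4 a b c e = cyc4 b c e a.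
Proof.
rewrite /cyc4 (setUC [set e] [set a]) (setUC [set b] [set a]).
by apply/setP=> p; rewrite !inE; do 4!case: (p == _).
Qed.

Lemma cyc4_rot2 a b c e : cyc4 a b c e = cyc4 c e a b.
Proof. by rewrite 2!cyc4_rot. Qed.

Lemma cyc4_flip a b c e : cyc4 a b c e = cyc4 b a e c.
Proof.
rewrite /cyc4 (setUC [set b] [set a]) (setUC [set e] [set c]).
by apply/setP=> p; rewrite !inE; do 4!case: (p == _).
Qed.

Lemma alt_cycleC E S : alt_cycle E S -> alt_cycle (predC E) S.
Proof.
case=> a [b] [c] [e] [/alternatingC alt_abce ->].
by exists b, c, e, a; rewrite cyc4_rot.
Qed.

Lemma cyc4P a b c e p :
  reflect [\/ p = [set a; b], p = [set c; e], p = [set a; e] | p = [set b; c]]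
          (p \in cyc4 a b c e).
Proof.
rewrite !inE -!orbA.
by apply: (iffP or4P) => -[/eqP->|/eqP->|/eqP->|/eqP->];
  rewrite ?eqxx; constructor.
Qed.

Lemma alternating_edgeP E a b c e p : alternating E a b c e ->
  p \in cyc4 a b c e -> E p -> p = [set a; b] \/ p = [set c; e].
Proof.
case/and5P=> _ _ _ ae bc /cyc4P[] ->; auto.
- by rewrite (negPf ae).
- by rewrite (negPf bc).
Qed.

Lemma alternating_nonedgeP E a b c e p : alternating E a b c e ->
  p \in cyc4 a b c e -> ~~ E p -> p = [set a; e] \/ p = [set b; c].
Proof. by case/and5P=> _ ab ce _ _ /cyc4P[] ->; rewrite ?ab ?ce; auto. Qed.

(** The two edges are opposite sides of a cycle on four distinct vertices. *)
Lemma alt_cycle_edges_disjoint E S p q x : alt_cycle E S ->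
  p \in S -> q \in S -> E p -> E q -> x \in p -> x \in q -> p = q.
Proof.
case=> a [b] [c] [e] [alt ->] pS qS Ep Eq.
case: (alternating_edgeP alt pS Ep) (alternating_edgeP alt qS Eq) => ->
  [] -> //; rewrite !inE; case/and5P: alt => /=; rewrite !inE !negb_or.
- case/and4P=> /and3P[_ /negPf ac /negPf ae] /andP[/negPf bc /negPf be] _ _ _ _
  _ _.
  by case/orP=> /eqP->; rewrite ?ac ?ae ?bc ?be.
- case/and4P=> /and3P[_ /negPf ac /negPf ae] /andP[/negPf bc /negPf be] _ _ _ _
  _ _.
  by case/orP=> /eqP->; rewrite eq_sym ?ac ?ae ?bc ?be // eq_sym ?ac ?ae ?bc
    ?be.
Qed.

Lemma alt_cycle_nonedges_disjoint E S p q x : alt_cycle E S ->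
  p \in S -> q \in S -> ~~ E p -> ~~ E q -> x \in p -> x \in q -> p = q.
Proof. by move=> /alt_cycleC; apply: alt_cycle_edges_disjoint. Qed.

(** An edge and a non-edge of the cycle are consecutive sides. *)
Lemma alt_cycle_meet E S p q : alt_cycle E S ->
  p \in S -> q \in S -> E p -> ~~ E q -> exists2 x, x \in p & x \in q.
Proof.
case=> a [b] [c] [e] [alt ->] pS qS Ep Eq.
case: (alternating_edgeP alt pS Ep) (alternating_nonedgeP alt qS Eq) => ->
  [] ->; by [exists a; rewrite !inE eqxx ?orbT | exists b; rewrite !inE eqxx
    ?orbT
  | exists c; rewrite !inE eqxx ?orbT| exists e; rewrite !inE eqxx ?orbT].
Qed.

(** The flip and the half turn preserve colours and generate the four labellings whose first side is
    an edge; so any edge, with its ends in either order, can come first. *)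
Lemma alt_cycle_edge E S a b : alt_cycle E S -> [set a; b] \in S ->
  E [set a; b] -> exists c e, alternating E a b c e /\ S = cyc4 a b c e.
Proof.
case=> a' [b'] [c'] [e'] [alt ->] abS abE.
case: (alternating_edgeP alt abS abE) => /eq_set2[] [-> ->].
- by exists c', e'.
- by exists e', c'; split; [exact: alternating_flip | exact: cyc4_flip].
- by exists a', b'; split; [exact: alternating_rot2 | exact: cyc4_rot2].
- exists b', a'; split; first exact/alternating_flip/alternating_rot2.
  by rewrite -cyc4_flip cyc4_rot2.
Qed.

(** An edge and a non-edge meeting in [b] fix three vertices in order; only the fourth remains
    free. *)
Lemma alt_cycle_path E S a b c : alt_cycle E S ->
  E [set a; b] -> ~~ E [set b; c] -> [set a; b] \in S -> [set b; c] \in S ->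
  exists x, alternating E a b c x /\ S = cyc4 a b c x.
Proof.
move=> cS abE bcE abS bcS.
have [c' [x [alt defS]]] := alt_cycle_edge cS abS abE.
exists x; suff ->: c = c' by [].
rewrite defS in bcS.
case: (alternating_nonedgeP alt bcS bcE) => [|/set2_inj //].
by case/eq_set2=> -[? ?]; subst; case/and5P: alt; rewrite /= ?inE ?eqxx // => _;
  rewrite setUC (negPf bcE).
Qed.

(** * Intersection sizes, and families of cycles pairwise sharing two sides *)

Lemma alternating_sides_neq E a b c e : alternating E a b c e ->
  [&& [set a; b] != [set c; e], [set a; b] != [set a; e],
      [set a; b] != [set b; c], [set c; e] != [set a; e],
      [set c; e] != [set b; c] & [set a; e] != [set b; c]].
Proof.
case/and5P=> /= U abE ceE aeE bcE.
have neqE p q : E p -> ~~ E q -> p != q.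
  by move=> Ep; apply: contraNneq => <-.
rewrite (neqE _ _ abE aeE) (neqE _ _ abE bcE) (neqE _ _ ceE aeE)
  (neqE _ _ ceE bcE) /=.
move: U; rewrite !inE !negb_or -!andbA => /and5P[ab ac ae bc /andP[be _]].
apply/andP; split; apply/eqP=> /eq_set2[] [eq_a _].
- by rewrite eq_a eqxx in ac.
- by rewrite eq_a eqxx in ae.
- by rewrite eq_a eqxx in ab.
- by rewrite eq_a eqxx in ac.
Qed.

(** Since the four sides are distinct, a condition on the size of an intersection becomes one on a
    sum of four booleans, which case analysis settles. *)
Lemma card_cyc4I E a b c e B : alternating E a b c e ->
  #|cyc4 a b c e :&: B| =
  ([set a; b] \in B) + ([set c; e] \in B) + ([set a; e] \in B)
  + ([set b; c] \in B).
Proof.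
move/alternating_sides_neq=> /and5P[n1 n2 n3 n4 /andP[n5 n6]].
rewrite -sum1_card; under eq_bigl => p do rewrite inE.
rewrite big_mkcondr /= /cyc4 -!setUA !big_setU1 ?big_set1 ?inE ?negb_or ?n1 ?n2
  ?n3 ?n4 ?n5 ?n6 //= !addnA.
by do 4!case: (_ \in B).
Qed.

Lemma card_cyc4 E a b c e : alternating E a b c e -> #|cyc4 a b c e| = 4.
Proof.
by move=> alt; rewrite -[cyc4 _ _ _ _]setIT (card_cyc4I _ alt) !inE.
Qed.

Lemma card_alt_cycle E S : alt_cycle E S -> #|S| = 4.
Proof. by case=> a [b] [c] [e] [/card_cyc4 ? ->]. Qed.

(* If S1 and S2 share both edges ab and ce, then their non-edges form a 4-cycle
   on the same four vertices, and non-edges of S1 and S2 always meet; so S3 must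
   contain ab and ce as well, and then S3 is S1 or S2. *)
Lemma shared_edges_absurd E S1 S2 S3 p q :
  alt_cycle E S1 -> alt_cycle E S2 -> alt_cycle E S3 ->
  #|S1 :&: S2| = 2 -> #|S1 :&: S3| = 2 -> #|S2 :&: S3| = 2 ->
  p != q -> p \in S1 :&: S2 -> q \in S1 :&: S2 -> E p -> E q -> False.
Proof.
move=> cS1 cS2 cS3 I12 I13 I23 pq /setIP[p1 p2] /setIP[q1 q2] Ep Eq.
case: (cS1) => a [b] [c] [e] [].
wlog: a b c e / p = [set a; b].
  move=> IH alt defS1; move: (p1); rewrite defS1.
  case/(alternating_edgeP alt)=> // defp; first exact: (IH a b c e).
  apply: (IH c e a b) => //; first exact: alternating_rot2.
  by rewrite defS1 cyc4_rot2.
move=> defp alt defS1.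
have defq: q = [set c; e].
  move: (q1); rewrite defS1; case/(alternating_edgeP alt)=> // q_ab.
  by rewrite defp q_ab eqxx in pq.
subst p q.
(* Two disjoint edges complete to a 4-cycle in only two ways. *)
have other S : alt_cycle E S -> [set a; b] \in S -> [set c; e] \in S ->
    S = cyc4 a b c e \/ S = cyc4 a b e c /\ alternating E a b e c.
  move=> cS abS ceS; have [c' [e' [alt' defS]]] := alt_cycle_edge cS abS Ep.
  move: ceS; rewrite defS; case/(alternating_edgeP alt')=> // ce_ab.
    by rewrite ce_ab eqxx in pq.
  by case/eq_set2: ce_ab => -[-> ->]; auto.
case: (other _ cS2 p2 q2) => [defS2|[defS2 alt2]].
  by rewrite defS1 defS2 setIid (card_cyc4 alt) in I12.
case/and5P: (alt) => U _ _ aeE bcE; case/and5P: (alt2) => _ _ _ acE beE.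
have apart x (r s : {set V}) : x \in r -> x \in s -> r != s -> ~~ E r -> ~~ E s
  ->
    ~~ ((r \in S3) && (s \in S3)).
  move=> xr xs rs Er Es; apply: contra rs => /andP[r3 s3].
  exact/eqP/(alt_cycle_nonedges_disjoint cS3 r3 s3 Er Es xr xs).
have neq x y z : x != y -> x != z -> forall t, [set x; t] != [set y; z].
  move=> xy xz t; apply: contraNneq xy => /eq_set2[] [xE _]; first exact/eqP.
  by rewrite xE eqxx in xz.
move: U; rewrite /= !inE !negb_or -!andbA => /and5P[ab ac ae bc /andP[be]].
case/andP=> ce _.
have A1 : ~~ (([set a; e] \in S3) && ([set a; c] \in S3)).
  apply: (apart a); rewrite ?inE ?eqxx //.
  by rewrite setUC neq // eq_sym.
have A2 : ~~ (([set a; e] \in S3) && ([set b; e] \in S3)).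
  by apply: (apart e); rewrite ?inE ?eqxx ?orbT // neq.
have A3 : ~~ (([set b; c] \in S3) && ([set a; c] \in S3)).
  by apply: (apart c); rewrite ?inE ?eqxx ?orbT // neq // eq_sym.
have A4 : ~~ (([set b; c] \in S3) && ([set b; e] \in S3)).
  apply: (apart b); rewrite ?inE ?eqxx //.
  by rewrite setUC neq // eq_sym.
move: (I13) (I23).
rewrite {1}defS1 {1}defS2 (card_cyc4I _ alt) (card_cyc4I _ alt2).
rewrite [[set e; c]]setUC => C13 C23.
have [ab3 ce3] : [set a; b] \in S3 /\ [set c; e] \in S3.
  by move: A1 A2 A3 A4 C13 C23; do 6!case: (_ \in S3).
case: (other _ cS3 ab3 ce3) => [|[]] defS3.
  by rewrite defS1 defS3 setIid (card_cyc4 alt) in I13.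
by rewrite defS2 defS3 setIid (card_cyc4 alt2) in I23.
Qed.

(** Two shared edges are impossible, and two shared non-edges are two shared edges for [predC E]. *)
Lemma shared_sides_colors E S1 S2 S3 p q :
  alt_cycle E S1 -> alt_cycle E S2 -> alt_cycle E S3 ->
  #|S1 :&: S2| = 2 -> #|S1 :&: S3| = 2 -> #|S2 :&: S3| = 2 ->
  p != q -> p \in S1 :&: S2 -> q \in S1 :&: S2 -> E p = ~~ E q.
Proof.
move=> cS1 cS2 cS3 I12 I13 I23 pq pI qI.
case Ep: (E p); case Eq: (E q) => //=; exfalso.
  exact: (shared_edges_absurd cS1 cS2 cS3 I12 I13 I23 pq pI qI).
apply: (shared_edges_absurd (alt_cycleC cS1) (alt_cycleC cS2)
  (alt_cycleC cS3) I12 I13 I23 pq pI qI); by rewrite /= ?Ep ?Eq.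
Qed.

Lemma alt_cycle_side_card E S p : alt_cycle E S -> p \in S -> #|p| = 2.
Proof.
case=> a [b] [c] [e] [/and5P[U _ _ _ _] ->] pS.
move: U; rewrite /= !inE !negb_or -!andbA => /and5P[ab ac ae bc /andP[be]].
by case/andP=> ce _; case/cyc4P: pS => ->; rewrite cards2 ?ab ?ae ?bc ?ce.
Qed.

Lemma card2_mem p x : #|p| = 2 -> x \in p -> exists y, p = [set x; y].
Proof.
move/eqP/cards2P=> [y [z [_ ->]]]; rewrite !inE => /orP[]/eqP->.
  by exists z.
by exists y; rewrite setUC.
Qed.

(** The two shared sides have different colours, hence are consecutive in [S1]; [b] is the vertex
    where they meet. *)
Lemma shared_path E S1 S2 S3 :
  alt_cycle E S1 -> alt_cycle E S2 -> alt_cycle E S3 ->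
  #|S1 :&: S2| = 2 -> #|S1 :&: S3| = 2 -> #|S2 :&: S3| = 2 ->
  exists a b c, [/\ E [set a; b], ~~ E [set b; c],
    [set a; b] \in S1 :&: S2 & [set b; c] \in S1 :&: S2].
Proof.
move=> cS1 cS2 cS3 I12 I13 I23.
have /eqP/cards2P[p [q [pq defI]]] := I12.
wlog [Ep Eq] : p q pq defI / E p /\ ~~ E q.
  have /= := shared_sides_colors cS1 cS2 cS3 I12 I13 I23 pq.
  rewrite defI !inE !eqxx orbT => /(_ isT isT) col IH.
  case Eq: (E q) in col.
    apply: (IH q p); rewrite 1?eq_sym // 1?setUC //.
    by rewrite Eq col.
  by apply: (IH p q); rewrite // Eq col.
have pI : p \in S1 :&: S2 by rewrite defI !inE eqxx.
have qI : q \in S1 :&: S2 by rewrite defI !inE eqxx orbT.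
have [[p1 _] [q1 _]] := (setIP pI, setIP qI).
have [b bp bq] := alt_cycle_meet cS1 p1 q1 Ep Eq.
have [a defp] := card2_mem (alt_cycle_side_card cS1 p1) bp.
have [c defq] := card2_mem (alt_cycle_side_card cS1 q1) bq.
by exists a, b, c; rewrite [[set a; b]]setUC -defp -defq.
Qed.

(** Write [S1] as a b c x and [S2] as a b c y. A side of [S1] off the path a-b-c and a side of [S2]
    off it cannot both lie in [S3]: if they have the same colour they share [a] or [c], and if not
    they are disjoint, whereas sides of [S3] behave the opposite way. So [S3] misses [cx] and [ax],
    or [cy] and [ay], and the two sides it shares with that cycle are [ab] and [bc]. *)
Lemma shared_path_mem E S1 S2 S3 a b c :
  alt_cycle E S1 -> alt_cycle E S2 -> alt_cycle E S3 ->
  #|S1 :&: S2| = 2 -> #|S1 :&: S3| = 2 -> #|S2 :&: S3| = 2 ->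
  E [set a; b] -> ~~ E [set b; c] ->
  [set a; b] \in S1 :&: S2 -> [set b; c] \in S1 :&: S2 ->
  [set a; b] \in S3 /\ [set b; c] \in S3.
Proof.
move=> cS1 cS2 cS3 I12 I13 I23 abE bcE /setIP[ab1 ab2] /setIP[bc1 bc2].
have [x [alt1 defS1]] := alt_cycle_path cS1 abE bcE ab1 bc1.
have [y [alt2 defS2]] := alt_cycle_path cS2 abE bcE ab2 bc2.
have xy : x != y.
  apply: contra_eqN I12 => /eqP xy.
  by rewrite defS1 defS2 xy setIid (card_cyc4 alt2).
case/and5P: (alt1) => U1 _ cxE axE _; case/and5P: (alt2) => U2 _ cyE ayE _.
move: U1; rewrite /= !inE !negb_or -!andbA => /and5P[ab ac ax bc /andP[bx]].
case/andP=> cx _.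
move: U2; rewrite /= !inE !negb_or -!andbA => /and5P[_ _ ay _ /andP[by_]].
case/andP=> cy _.
have A1 : ~~ (([set c; x] \in S3) && ([set c; y] \in S3)).
  apply: contra xy => /andP[cx3 cy3]; apply/eqP/(@set2_inj c).
  by apply: (alt_cycle_edges_disjoint cS3 (x := c)); rewrite // !inE eqxx.
have A2 : ~~ (([set a; x] \in S3) && ([set a; y] \in S3)).
  apply: contra xy => /andP[ax3 ay3]; apply/eqP/(@set2_inj a).
  by apply: (alt_cycle_nonedges_disjoint cS3 (x := a)); rewrite // !inE eqxx.
have A3 : ~~ (([set c; x] \in S3) && ([set a; y] \in S3)).
  apply/negP=> /andP[cx3 ay3].
  have [z] := alt_cycle_meet cS3 cx3 ay3 cxE ayE; rewrite !inE.
  case/orP=> /eqP->; rewrite 1?(negPf xy) 1?(negPf cy);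
  by rewrite eq_sym ?(negPf ac) ?(negPf ax).
have A4 : ~~ (([set a; x] \in S3) && ([set c; y] \in S3)).
  apply/negP=> /andP[ax3 cy3].
  have [z] := alt_cycle_meet cS3 cy3 ax3 cyE axE; rewrite !inE.
  case/orP=> /eqP->; rewrite [_ == a]eq_sym ?(negPf ac) ?(negPf cx) //.
  by rewrite (negPf ay) eq_sym (negPf xy).
move: I13 I23; rewrite defS1 defS2 (card_cyc4I _ alt1) (card_cyc4I _ alt2).
by move: A1 A2 A3 A4; do 6!case: (_ \in S3).
Qed.

(** The path shared by two of the cycles is the kernel. A third cycle is required to find it, since
    two cycles alone may share two edges. *)
Lemma alt_cycles_sunflower E (I : finType) (D : {set I})
    (S : I -> {set {set V}}) : 2 < #|D| ->
  {in D, forall i, alt_cycle E (S i)} ->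
  {in D &, forall i j, i != j -> #|S i :&: S j| = 2} ->
  exists a b c, {in D, forall i, exists x,
    alternating E a b c x /\ S i = cyc4 a b c x}.
Proof.
case/card_gt2P=> i [j] [k] [[iD jD kD] [ij jk ki]] cS IS.
have [a [b [c [abE bcE abI bcI]]]] : exists a b c, [/\ E [set a; b],
    ~~ E [set b; c], [set a; b] \in S i :&: S j & [set b; c] \in S i :&: S j].
  by apply: (shared_path (cS i iD) (cS j jD) (cS k kD)); apply: IS;
    rewrite // eq_sym.
exists a, b, c => l lD.
suff [abl bcl] : [set a; b] \in S l /\ [set b; c] \in S l.
  exact: alt_cycle_path (cS l lD) abE bcE abl bcl.
case: (eqVneq i l) => [<-|il]; first by case/setIP: abI; case/setIP: bcI.
case: (eqVneq j l) => [<-|jl]; first by case/setIP: abI; case/setIP: bcI.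
by apply: (shared_path_mem (cS i iD) (cS j jD) (cS l lD)); rewrite ?IS.
Qed.

End AlternatingCycles.

(** * 2-switches as symmetric differences with alternating 4-cycles *)

Section Switches.

Variable V : finType.
Implicit Types (A B : {set {set V}}) (G H : sgraph V) (a b c e x y : V).

Definition symdiff A B : {set {set V}} :=
  [set p | (p \in A) (+) (p \in B)].

Lemma symdiffC A B : symdiff A B = symdiff B A.
Proof. by apply/setP=> p; rewrite !inE addbC. Qed.

Lemma symdiffKl A B : symdiff A (symdiff A B) = B.
Proof. by apply/setP=> p; rewrite !inE addKb. Qed.

Lemma symdiff_cancel A B C :
  symdiff (symdiff C A) (symdiff C B) = symdiff A B.
Proof. by apply/setP=> p; rewrite !inE; do 3!case: (p \in _). Qed.

Lemma card_symdiff A B : #|symdiff A B| + #|A :&: B| * 2 = #|A| + #|B|.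
Proof.
have defU : A :|: B = symdiff A B :|: (A :&: B).
  by apply/setP=> p; rewrite !inE; do 2!case: (p \in _).
have disj : symdiff A B :&: (A :&: B) = set0.
  by apply/setP=> p; rewrite !inE; do 2!case: (p \in _).
by rewrite -cardsUI defU cardsU disj cards0 subn0 muln2 -addnn addnA.
Qed.

(** With this predicate, [alternating (is_edge G)] is convertible to [alt4 G], so the lemmas above
    apply to [alt4] directly. *)
Definition is_edge G : pred {set V} := fun p => p \in edges G.

Lemma switchedE G a b c e : alt4 G a b c e ->
  switched G a b c e = symdiff (edges G) (cyc4 a b c e).
Proof.
case/and5P=> _ ab ce ae bc; apply/setP=> p; rewrite !inE.
case: (eqVneq p [set a; e]) => [->|_]; first by rewrite (negPf ae) !orbT.
case: (eqVneq p [set b; c]) => [->|_]; first by rewrite (negPf bc) !orbT.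
case: (eqVneq p [set a; b]) => [->|_]; first by rewrite ab.
case: (eqVneq p [set c; e]) => [->|_]; first by rewrite ce.
by rewrite /= addbF orbF.
Qed.

Lemma two_switchP G H :
  two_switch G H <-> alt_cycle (is_edge G) (symdiff (edges G) (edges H)).
Proof.
split.
  case/existsP=> a /existsP[b /existsP[c /existsP[e /andP[alt /eqP defH]]]].
  by exists a, b, c, e; rewrite defH switchedE // symdiffKl.
case=> a [b] [c] [e] [alt defS].
do 4![apply/existsP; eexists]; apply/andP; split; first exact: alt.
by rewrite switchedE // -defS symdiffKl.
Qed.

(** Toggling reverses the colour of every side, so the same cycle read from its second vertex
    alternates in [H]; this is what makes a 2-switch reversible. *)
Lemma alternating_switched G H a b c e :
  edges H = symdiff (edges G) (cyc4 a b c e) ->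
  alternating (is_edge G) a b c e -> alternating (is_edge H) b c e a.
Proof.
move=> defH /alternatingC/and5P[U bc ea ba ce].
have flip p : p \in cyc4 a b c e -> is_edge H p = ~~ is_edge G p.
  by move=> pC; rewrite /is_edge defH in_set pC addbT.
by apply/and5P; split=> //; rewrite flip // cyc4_rot !inE eqxx ?orbT.
Qed.

Lemma two_switch_sym G H : two_switch G H -> two_switch H G.
Proof.
move=> /two_switchP[a [b [c [e [alt defS]]]]]; apply/two_switchP.
exists b, c, e, a; split; last by rewrite symdiffC defS cyc4_rot.
by apply: alternating_switched alt; rewrite -defS symdiffKl.
Qed.

Lemma card_symdiff_two_switch G H :
  two_switch G H -> #|symdiff (edges G) (edges H)| = 4.
Proof. by move/two_switchP/card_alt_cycle. Qed.

(** The symmetric difference of the two cycles is that of [H1] and [H2], again of size 4; if s sides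
    are common, then 4 + 2s = 4 + 4. *)
Lemma two_switch_common G H1 H2 :
  two_switch G H1 -> two_switch G H2 -> two_switch H1 H2 ->
  #|symdiff (edges G) (edges H1) :&: symdiff (edges G) (edges H2)| = 2.
Proof.
move=> /card_symdiff_two_switch c1 /card_symdiff_two_switch c2.
move/card_symdiff_two_switch; rewrite -(symdiff_cancel _ _ (edges G)).
move=> c12; have := card_symdiff (symdiff (edges G) (edges H1))
  (symdiff (edges G) (edges H2)).
by rewrite c1 c2 c12 => /eqP; rewrite -[4 + 4]/(4 + 2 * 2) eqn_add2l eqn_pmul2r
  // => /eqP.
Qed.

(** The common sides [ab] and [bc] cancel, and the remaining paths a-x-c and a-y-c close up to a
    4-cycle. *)
Lemma symdiff_cyc4 E a b c x y :
  alternating E a b c x -> alternating E a b c y -> x != y ->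
  symdiff (cyc4 a b c x) (cyc4 a b c y) = cyc4 a x c y.
Proof.
move=> alt1 alt2 xy.
have /and5P[n1 n2 n3 n4 /andP[n5 n6]] := alternating_sides_neq alt1.
have /and5P[m1 m2 m3 m4 /andP[m5 m6]] := alternating_sides_neq alt2.
case/and5P: alt1 => _ _ cx ax _; case/and5P: alt2 => _ _ cy ay _.
have k1 : [set c; x] != [set c; y] by apply: contraNneq xy => /set2_inj->.
have k2 : [set a; x] != [set a; y] by apply: contraNneq xy => /set2_inj->.
have k3 : [set c; x] != [set a; y] by apply: contraNneq ay => <-.
have k4 : [set c; y] != [set a; x] by apply: contraNneq ax => <-.
apply/setP=> p; rewrite !inE [[set x; c]]setUC.
case: (eqVneq p [set a; b]) => [->|_]; first by rewrite (negPf m1) (negPf n2)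
  (negPf n1) (negPf m2).
case: (eqVneq p [set b; c]) => [->|_].
  by rewrite !orbT; rewrite ![[set b; c] == _]eq_sym (negPf m5) (negPf m6)
    (negPf n5) (negPf n6).
case: (eqVneq p [set c; x]) => [->|_]; first by rewrite (negPf k1) (negPf k3)
  (negPf n4).
case: (eqVneq p [set c; y]) => [->|_]; first by rewrite (negPf m4) (negPf k4).
case: (eqVneq p [set a; x]) => [->|_]; first by rewrite (negPf k2).
by case: (eqVneq p [set a; y]).
Qed.

(** In [H1] the first switch has made [ax] an edge and [cx] a non-edge, while [cy] and [ay] keep
    their status from [G]; hence a x c y alternates in [H1]. *)
Lemma two_switch_same_path G H1 H2 a b c x y :
  alt4 G a b c x -> alt4 G a b c y -> x != y ->
  edges H1 = switched G a b c x -> edges H2 = switched G a b c y ->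
  two_switch H1 H2.
Proof.
move=> alt1 alt2 xy; rewrite !switchedE // => defH1 defH2.
apply/two_switchP; rewrite defH1 defH2 symdiff_cancel.
rewrite (symdiff_cyc4 (E := is_edge G) alt1 alt2 xy).
exists a, x, c, y; split=> //.
have /and5P[U1 _ xaE _ cxE] := alternating_switched defH1 alt1.
have /and5P[U2 _ cyE ayE _] := alt2.
have /and5P[_ _ cxG axG _] := alt1.
have /and5P[m1 m2 _ _ /andP[m5 m6]] :=
  alternating_sides_neq (alt2 : alternating (is_edge G) a b c y).
have k1 : [set c; y] != [set c; x].
  by apply: contraNneq xy => /set2_inj->.
have k2 : [set a; y] != [set a; x].
  by apply: contraNneq xy => /set2_inj->.
have k3 : [set c; y] != [set a; x] by apply: contraNneq axG => <-.
have k4 : [set a; y] != [set c; x] by apply: contraNneq ayE => ->.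
apply/and5P; split.
- move: U1 U2 xy; rewrite /= !inE !negb_or -!andbA.
  case/and5P=> _ _ _ n_cx /and3P[n_ca n_xa _].
  case/and5P=> _ n_ac n_ay _ /and3P[_ n_cy _] n_xy.
  by rewrite eq_sym n_xa n_ac n_ay eq_sym n_cx n_xy n_cy.
- by rewrite setUC.
- rewrite /is_edge defH1 inE cyE !inE (negPf k1) (negPf k3) (negPf m5).
  by rewrite eq_sym (negPf m1).
- rewrite /is_edge defH1 inE (negPf ayE) !inE (negPf k2) (negPf k4) (negPf m6).
  by rewrite eq_sym (negPf m2).
- by rewrite setUC.
Qed.

(** * 2-switches preserve degrees and simplicity *)

Lemma degreeE G (v : V) : degree G v = \sum_(p in edges G) (v \in p).
Proof.
rewrite /degree -sum1_card; under eq_bigl => p do rewrite inE.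
by rewrite big_mkcondr /=; apply: eq_bigr => p _; case: (v \in p).
Qed.

(** The deleted pairs [ab], [ce] and the added pairs [ae], [bc] each cover every one of the four
    vertices exactly once. *)
Lemma degree_switched G H a b c e v : alt4 G a b c e ->
  edges H = switched G a b c e -> degree H v = degree G v.
Proof.
move=> alt defH; rewrite !degreeE defH /switched.
have /and5P[n1 _ _ _ /andP[_ n6]] :=
  alternating_sides_neq (alt : alternating (is_edge G) a b c e).
case/and5P: alt => U ab ce ae bc.
rewrite setUC -setUA !big_setU1 /= ?inE ?negb_or ?n6 ?(negPf ae) ?(negPf bc)
  ?andbF //.
rewrite [RHS](big_setID [set [set a; b]; [set c; e]]) /=.
have -> : edges G :&: [set [set a; b]; [set c; e]] = [set [set a; b]; [set c;
  e]].
  by apply/setIidPr/subsetP=> p; rewrite !inE => /orP[]/eqP->.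
rewrite big_setU1 ?inE //= big_set1 addnA; congr (_ + _).
move: U; rewrite /= !inE !negb_or -!andbA => /and5P[n_ab n_ac n_ae n_bc
  /andP[n_be]].
case/andP=> n_ce _.
case: (eqVneq v a) => [->|_]; first by rewrite (negPf n_ab) (negPf n_ac) (negPf
  n_ae).
case: (eqVneq v b) => [->|_]; first by rewrite (negPf n_bc) (negPf n_be).
by case: (eqVneq v c) => [->|_]; [rewrite (negPf n_ce) | case: (v == e)].
Qed.

Lemma switched_sgraph G a b c e : alt4 G a b c e ->
  exists H : sgraph V, edges H = switched G a b c e.
Proof.
case/and5P=> U _ _ _ _.
have card2 : [forall p in switched G a b c e, #|p| == 2].
  apply/forall_inP=> p; rewrite !inE.
  move: U; rewrite /= !inE !negb_or -!andbA => /and5P[_ _ n_ae n_bc _].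
  case/or3P=> [/andP[_ /andP[_ pG]]|/eqP->|/eqP->];
    rewrite ?cards2 ?n_ae ?n_bc //.
  by case: (G) pG => E /= /forall_inP; apply.
by exists (SGraph card2).
Qed.

End Switches.

(** * Adjacency and cliques in the realization graph *)

Section Realizations.

Variables (m : nat) (d : m.-tuple nat).
Implicit Types R H : realization d.

Lemma realization_edges_inj R H : edges R = edges H -> R = H.
Proof. by move=> eqE; apply/val_inj/val_inj. Qed.

Lemma switched_realization R a b c e : alt4 R a b c e ->
  exists H : realization d, edges H = switched R a b c e.
Proof.
move=> alt; have [H defH] := switched_sgraph alt.
have degH : [forall i, degree H i == tnth d i].
  apply/forallP=> i; rewrite (degree_switched _ alt defH).
  by case: (R) => G /= /forallP; apply.
by exists (Realization degH).
Qed.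

(** Edges are unordered while [two_switch] is directed, so one of the two orders of the ends calls
    for its symmetry. *)
Lemma realization_graph_edge R H :
  ([set R; H] \in edges (realization_graph d)) = two_switch R H.
Proof.
rewrite inE; apply/existsP/idP.
  case=> A /existsP[B /andP[/eqP/eq_set2 eqAB swAB]].
  by case: eqAB => -[-> ->]; [exact: swAB | apply: two_switch_sym].
by move=> RH; exists R; apply/existsP; exists H; rewrite eqxx.
Qed.

Lemma realization_cliqueP (K : {set realization d}) :
  reflect {in K &, forall R H, R != H -> two_switch R H}
          (clique (realization_graph d) K).
Proof.
apply: (iffP forall_inP) => cK R.
  move=> H RK HK RH; move: (forall_inP (cK R RK) H HK).
  by rewrite RH realization_graph_edge.
move=> RK; apply/forall_inP=> H HK; apply/implyP=> RH.
by rewrite realization_graph_edge; apply: cK.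
Qed.

End Realizations.

(** * Copies of the configuration D_n, with n = k + 1 *)

Section Copies.

Variables (V : finType) (G : sgraph V) (k : nat).
Variable f : cvert (Dconf k.+1) -> V.
Let a := f (Du k.+1).
Let b := f (Dw ord0).
Let c := f (Dv k.+1).
Let w (i : 'I_k.+1) := f (Dw i).

Lemma imset_set2 (x y : cvert (Dconf k.+1)) :
  f @: [set x; y] = [set f x; f y].
Proof. by rewrite imsetU1 imset_set1. Qed.

Lemma copy_edgesP p :
  reflect (p = [set a; b] \/ exists2 i, i != ord0 & p = [set c; w i])
    (p \in [set f @: (q : {set cvert (Dconf k.+1)}) | q in cedges (Dconf k.+1)]).
Proof.
apply: (iffP imsetP) => [[q]|].
  case/setUP=> /imsetP[i]; rewrite inE => i0 -> ->; rewrite imset_set2.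
    by left; congr [set _; f (Dw _)]; apply/val_inj/eqP.
  by right; exists i.
case=> [->|[i i0 ->]].
  exists [set Du k.+1; Dw ord0]; last by rewrite imset_set2.
  by apply/setUP; left; apply: imset_f; rewrite inE.
exists [set Dv k.+1; Dw i]; last by rewrite imset_set2.
by apply/setUP; right; apply: imset_f; rewrite inE.
Qed.

Lemma copy_nonedgesP p :
  reflect (p = [set c; b] \/ exists2 i, i != ord0 & p = [set a; w i])
    (p \in [set f @: (q : {set cvert (Dconf k.+1)}) | q in cnonedges (Dconf k.+1)]).
Proof.
apply: (iffP imsetP) => [[q]|].
  case/setUP=> /imsetP[i]; rewrite inE => i0 -> ->; rewrite imset_set2.
    by left; congr [set _; f (Dw _)]; apply/val_inj/eqP.
  by right; exists i.
case=> [->|[i i0 ->]].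
  exists [set Dv k.+1; Dw ord0]; last by rewrite imset_set2.
  by apply/setUP; left; apply: imset_f; rewrite inE.
exists [set Du k.+1; Dw i]; last by rewrite imset_set2.
by apply/setUP; right; apply: imset_f; rewrite inE.
Qed.

Lemma copy_alt4 i : config_copy G f -> i != ord0 -> alt4 G a b c (w i).
Proof.
case=> f_inj fE fN i0.
have edge p : p = [set a; b] \/ (exists2 i, i != ord0 & p = [set c; w i]) ->
  p \in edges G by move/copy_edgesP/imsetP=> [q /fE qG ->].
have nonedge p : p = [set c; b] \/ (exists2 i, i != ord0 & p = [set a; w i]) ->
  p \notin edges G by move/copy_nonedgesP/imsetP=> [q /fN qG ->].
apply/and5P; split.
- rewrite (map_inj_uniq f_inj [:: Du k.+1; Dw ord0; Dv k.+1; Dw i]) /=.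
  by rewrite !inE andbT; apply: contra i0 => /eqP[->].
- by apply: edge; left.
- by apply: edge; right; exists i.
- by apply: nonedge; right; exists i.
- by rewrite setUC; apply: nonedge; left.
Qed.

(** The cycles a b c w_i cover all pairs of the configuration; [0 < k] supplies at least one of
    them, and with it [ab] and [bc]. *)
Lemma config_copy_alt4 : 0 < k -> injective f ->
  (forall i, i != ord0 -> alt4 G a b c (w i)) -> config_copy G f.
Proof.
move=> k_gt0 f_inj alt.
have max0 : (ord_max : 'I_k.+1) != ord0 by rewrite -val_eqE -lt0n.
split=> // q qC.
  have /copy_edgesP[->|[i i0 ->]] := imset_f (fun q : {set _} => f @: q) qC.
    by case/and5P: (alt _ max0).
  by case/and5P: (alt i i0).
have /copy_nonedgesP[->|[i i0 ->]] := imset_f (fun q : {set _} => f @: q) qC.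
  by rewrite setUC; case/and5P: (alt _ max0).
by case/and5P: (alt i i0).
Qed.

Lemma alt4_in_copy_path i : i != ord0 -> alt4_in_copy f a b c (w i).
Proof.
move=> i0; split.
- by apply/copy_edgesP; left.
- by apply/copy_edgesP; right; exists i.
- by apply/copy_nonedgesP; right; exists i.
- by apply/copy_nonedgesP; left; rewrite setUC.
Qed.

(* Two edges of the copy other than ab share c, and two non-edges other than bc
   share a, so an alternating 4-cycle of the copy uses both ab and bc. *)
Lemma switched_in_copy a' b' c' e' : config_copy G f -> alt4 G a' b' c' e' ->
  alt4_in_copy f a' b' c' e' ->
  exists2 i, i != ord0 & switched G a' b' c' e' = switched G a b c (w i).
Proof.
move=> fG alt [/copy_edgesP ab' /copy_edgesP ce' /copy_nonedgesP ae'
  /copy_nonedgesP bc'].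
have /and5P[n1 _ _ _ /andP[_ n6]] :=
  alternating_sides_neq (alt : alternating (is_edge G) a' b' c' e').
set S := cyc4 a' b' c' e'.
have cS : alt_cycle (is_edge G) S by exists a', b', c', e'.
have [abS ceS aeS bcS] : [/\ [set a'; b'] \in S, [set c'; e'] \in S,
    [set a'; e'] \in S & [set b'; c'] \in S].
  by split; rewrite !inE eqxx ?orbT.
case/and5P: (alt) => _ abG ceG aeG bcG.
have [i i0 [abS1 cwS]] : exists2 i, i != ord0 &
    [set a; b] \in S /\ [set c; w i] \in S.
  case: ab' ce' => [eab|[i i0 eab]] [ece|[j j0 ece]].
  - by rewrite eab ece eqxx in n1.
  - by exists j; rewrite -?eab -?ece.
  - by exists i; rewrite -?eab -?ece.
  have /eqP[] := n1; apply: (alt_cycle_edges_disjoint cS abS ceS abG ceG (x :=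
    c));
    by rewrite ?eab ?ece !inE eqxx.
have bcS1 : [set b; c] \in S.
  rewrite setUC; case: ae' bc' => [eae|[l l0 eae]] [ebc|[j j0 ebc]];
    rewrite -?eae -?ebc //.
  have /eqP[] := n6; apply: (alt_cycle_nonedges_disjoint cS aeS bcS aeG bcG (x
    := a));
    by rewrite ?eae ?ebc !inE eqxx.
have alti := copy_alt4 fG i0; case/and5P: (alti) => _ abE cwE _ bcE.
(* The path a-b-c leaves only the fourth vertex of [S] open, and the edge from [c] to [w i]
   identifies it. *)
have [x [altx defS]] := alt_cycle_path cS abE bcE abS1 bcS1.
exists i => //; suff defx : w i = x by rewrite !switchedE // -/S defS defx.
rewrite defS in cwS; case: (alternating_edgeP altx cwS cwE) => [cw_ab|/set2_inj
  //].
have /and5P[/eqP[]] := alternating_sides_neq (alti : alternating (is_edge G) a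
  b c (w i)).
by rewrite cw_ab.
Qed.

End Copies.

(** * From copies of D_n to cliques, and back *)

Lemma copy_clique m (d : m.-tuple nat) (R : realization d) k
    (f : cvert (Dconf k.+1) -> 'I_m) : config_copy R f ->
  exists K : {set realization d},
    [/\ #|K| = k.+1, R \in K & clique (realization_graph d) K].
Proof.
move=> fR; have [f_inj _ _] := fR.
set a := f (Du k.+1); set b := f (Dw ord0); set c := f (Dv k.+1).
(* The index [ord0], which belongs to [b] and gives no cycle, is assigned to [R] itself, so that k +
   1 indices yield k + 1 vertices. *)
have /fin_all_exists[h hP] (i : 'I_k.+1) : exists H : realization d,
    if i == ord0 then H = R else edges H = switched R a b c (f (Dw i)).
  case: (eqVneq i ord0) => [_|i0]; first by exists R.
  exact: switched_realization (copy_alt4 fR i0).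
have sw0 j : j != ord0 -> two_switch R (h j).
  move=> j0; apply/two_switchP; have := hP j; rewrite (negPf j0) => ->.
  exists a, b, c, (f (Dw j)); rewrite switchedE ?copy_alt4 // symdiffKl.
  by split=> //; apply: copy_alt4.
have h0 : h ord0 = R by have := hP ord0.
have sw i j : i != j -> two_switch (h i) (h j).
  case: (eqVneq i ord0) => [->|i0] ij; first by rewrite h0 sw0 // eq_sym.
  case: (eqVneq j ord0) => [->|j0]; first by rewrite h0 two_switch_sym ?sw0.
  have := hP i; have := hP j; rewrite (negPf i0) (negPf j0) => hj hi.
  apply: two_switch_same_path hi hj; rewrite ?copy_alt4 //.
  by apply: contra ij => /eqP/f_inj[->].
(* Distinct indices give realizations related by a 2-switch, and no realization is a 2-switch of
   itself. *)
have h_inj : injective h.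
  move=> i j hij; apply/eqP; case: eqVneq => // /sw.
  by rewrite hij (negPf (two_switch_irrefl _)).
exists (h @: setT); split.
- by rewrite card_imset // cardsT card_ord.
- by rewrite -h0 imset_f.
- apply/realization_cliqueP=> _ _ /imsetP[i _ ->] /imsetP[j _ ->] hij.
  by apply: sw; apply: contra hij => /eqP->.
Qed.

(** The copy is built from [K]: each index other than [ord0] stands for one vertex of the clique
    other than [R], so the copy records exactly the moves inside [K]. *)
Lemma clique_copy m (d : m.-tuple nat) (R : realization d) k
    (K : {set realization d}) : 2 < k -> #|K| = k.+1 -> R \in K ->
  clique (realization_graph d) K ->
  exists f : cvert (Dconf k.+1) -> 'I_m,
    config_copy R f /\
    forall H : realization d,
      (H \in K /\ H <> R) <->
      exists a b c e : 'I_m,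
        [/\ alt4 R a b c e, alt4_in_copy f a b c e
          & edges H = switched R a b c e].
Proof.
move=> k_gt2 cardK RK /realization_cliqueP cK.
have cardD : #|K :\ R| = k by move: cardK; rewrite (cardsD1 R) RK => -[].
pose S (H : realization d) := symdiff (edges R) (edges H).
have sw H : H \in K :\ R -> two_switch R H.
  by case/setD1P=> HR HK; apply: cK; rewrite // eq_sym.
(* As [2 < k], the set [K :\ R] provides the three cycles that the sunflower lemma demands. *)
have [|||a [b [c abcP]]] :=
    @alt_cycles_sunflower _ (is_edge R) _ (K :\ R) S _ _ _.
- by rewrite cardD.
- by move=> H /sw/two_switchP.
- move=> H1 H2 D1 D2 H12; apply: two_switch_common; rewrite ?sw //.
  by case/setD1P: D1 => _ K1; case/setD1P: D2 => _ K2; apply: cK.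
(* [g H] is the fourth vertex of the cycle of [H]; outside [K :\ R] the value [a] is a mere
   default. *)
have /fin_all_exists[g gP] (H : realization d) : exists x, H \in K :\ R ->
    alt4 R a b c x /\ edges H = switched R a b c x.
  case: (boolP (H \in K :\ R)) => [/abcP[x [alt defS]]|_]; last by exists a.
  by exists x => _; rewrite switchedE // -defS symdiffKl.
(* With [R] in front, the nonzero indices enumerate [K :\ R], and index 0 is free to carry [b] in
   [w]. *)
pose s := R :: enum (K :\ R).
have size_s : size s = k.+1 by rewrite /= -cardE cardD.
have uniq_s : uniq s by rewrite /= mem_enum !inE eqxx enum_uniq.
pose h (i : 'I_k.+1) := nth R s i.
have hD i : i != ord0 -> h i \in K :\ R.
  case: i => [[|i]] //= lt_i _; rewrite /h /= -mem_enum mem_nth //.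
  by rewrite -cardE cardD.
have h_inj : injective h.
  move=> i j /eqP; rewrite nth_uniq ?size_s // => /eqP; exact: val_inj.
pose w (i : 'I_k.+1) := if i == ord0 then b else g (h i).
pose f (x : cvert (Dconf k.+1)) :=
  match x with inl true => a | inl false => c | inr i => w i end.
have alt i : i != ord0 -> alt4 R a b c (w i).
  by move=> i0; rewrite /w (negPf i0); case: (gP _ (hD i i0)).
have edges_h i : i != ord0 -> edges (h i) = switched R a b c (w i).
  by move=> i0; rewrite /w (negPf i0); case: (gP _ (hD i i0)).
have k_gt0 : 0 < k by apply: leq_trans k_gt2.
have uniq_w i : i != ord0 -> uniq [:: a; b; c; w i] by case/alt/and5P.
have max0 : (ord_max : 'I_k.+1) != ord0 by rewrite -val_eqE -lt0n.
have [ab ac bc] : [/\ a != b, a != c & b != c].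
  move: (uniq_w _ max0); rewrite /= !inE !negb_or -!andbA.
  by case/and5P=> -> -> _ ->.
have w_neq i : [/\ a != w i, c != w i & i != ord0 -> b != w i].
  case: (eqVneq i ord0) => [->|i0].
    by rewrite /w eqxx [c == b]eq_sym.
  move: (uniq_w _ i0); rewrite /= !inE !negb_or -!andbA.
  by case/and5P=> _ _ -> _ /and3P[-> ->].
have w_inj : injective w.
  have w0 : w ord0 = b by rewrite /w eqxx.
  move=> i j; case: (eqVneq i ord0) => [->|i0]; case: (eqVneq j ord0) =>
    [->|j0] //.
  - by move/eqP; rewrite w0; case: (w_neq j) => _ _ /(_ j0)/negPf->.
  - by move/esym/eqP; rewrite w0; case: (w_neq i) => _ _ /(_ i0)/negPf->.
  (* Equal fourth vertices give the same switch of [R], hence the same clique vertex and the same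
     index. *)
  - by move=> wij; apply/h_inj/realization_edges_inj; rewrite !edges_h // wij.
have f_inj : injective f.
  move=> [[]|i] [[]|j] //= /eqP; rewrite ?(negPf ac) //.
  - by case: (w_neq j) => /negPf->.
  - by rewrite eq_sym (negPf ac).
  - by case: (w_neq j) => _ /negPf->.
  - by rewrite eq_sym; case: (w_neq i) => /negPf->.
  - by rewrite eq_sym; case: (w_neq i) => _ /negPf->.
  - by move/eqP/w_inj->.
have fR : config_copy R f by apply: config_copy_alt4.
exists f; split=> // H; split.
  case=> HK /eqP HR.
  have Hs : H \in s by rewrite inE mem_enum !inE HK (negPf HR).
  have lt_i : index H s < k.+1 by rewrite -size_s index_mem.
  pose i := Ordinal lt_i; have hi : h i = H by rewrite /h nth_index.
  have i0 : i != ord0 by apply: contra HR => /eqP i0; rewrite -hi i0.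
  exists a, b, c, (w i); split; [exact: alt | | by rewrite -hi edges_h].
  exact: (alt4_in_copy_path f).
(* Any alternating 4-cycle inside the copy has the same switch as some a b c w_i, which leads to
   [h i] in [K :\ R]. *)
case=> a' [b'] [c'] [e'] [alt' in_f defH].
have [i i0 defsw] := switched_in_copy fR alt' in_f.
have -> : H = h i by apply: realization_edges_inj; rewrite defH edges_h.
by case/setD1P: (hD i i0) => /eqP.
Qed.

Theorem theorem6 (m : nat) (d : m.-tuple nat) (R : realization d) (n : nat)
    (hn : 4 <= n) :
  ((exists K : {set realization d},
      [/\ #|K| = n, R \in K & clique (realization_graph d) K])
    <-> contains R (Dconf n))
  /\
  (forall K : {set realization d},
     #|K| = n -> R \in K -> clique (realization_graph d) K ->
     exists f : cvert (Dconf n) -> 'I_m,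
       config_copy R f /\
       forall H : realization d,
         (H \in K /\ H <> R) <->
         exists a b c e : 'I_m,
           [/\ alt4 R a b c e, alt4_in_copy f a b c e
             & edges H = switched R a b c e]).
Proof.
case: n hn => // k k_gt2.
(* The copy attached to a clique for the second claim also gives the forward implication of the
   first. *)
have part2 (K : {set realization d}) := @clique_copy m d R k K k_gt2.
split=> //; split=> [[K [cardK RK cK]]|[f fR]]; last exact: copy_clique fR.
by have [f [fR _]] := part2 K cardK RK cK; exists f.
Qed.
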